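(* Let $\Phi$ be a continuous semiflow on a Banach space $(X,\|\cdot\|_X)$ which is eventually compact and possesses a global attractor $\Gamma$, and suppose that $\Phi$ is uniformly eventually strongly monotone (UESM) with respect to nested invariant cones (NICs) $\{C^i\}_{i=0}^{N}$. Then for every connected component $B$ of the Birkhoff center $\mathcal{B}(\Phi)$ there exists $j$ with $0<j\le N$ such that (a) $B$ is strongly ordered with $\{C^i\}_{i=j}^{N}$, i.e. strongly ordered with $C^i$ for every $i=j,\dots,N$; and (b) $B$ is unordered with $\{C^i\}_{i=0}^{j-1}$, i.e. unordered with $C^i$ for every $i=0,\dots,j-1$.
   Context: **Semiflows.** A continuous semiflow on a Banach space $X$ is a continuous map $\Phi:[0,\infty)\times X\to X$, $\Phi_t(x)=\Phi(t,x)$, with $\Phi_0=\mathrm{id}$ and $\Phi_t\circ\Phi_s=\Phi_{t+s}$ for $t,s\ge0$. It is eventually compact if there is $\tau>0$ such that $\Phi_\tau(D)$ is relatively compact for every bounded $D\subset X$. A set $A$ is invariant if $\Phi_t(A)=A$ for all $t\ge0$. A global attractor is a nonempty compact invariant set $\Gamma\subset X$ with $\lim_{t\to+\infty}\sup_{a\in\Phi_t(D)}\inf_{b\in\Gamma}\|a-b\|_X=0$ for every bounded $D\subset X$. The $\omega$-limit set is $\omega(x)=\bigcap_{t\ge0}\overline{\bigcup_{s\ge t}\{\Phi_s(x)\}}$. The point $x$ is recurrent if $x\in\omega(x)$; $\mathcal{R}(\Phi)$ is the set of recurrent points, and the Birkhoff center is $\mathcal{B}(\Phi)=\overline{\mathcal{R}(\Phi)}$.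 **Cones.** A closed set $C\subset X$ is a $k$-cone if $lv\in C$ for all $v\in C$, $l\in\mathbb{R}$, and $\max\{\dim W: W\subset C \text{ a linear subspace}\}=k$. It is solid if $\operatorname{Int}C\ne\emptyset$. (Cones are not assumed convex.) A set $S\subset X$ is unordered with $C$ if there are no distinct $x,y\in S$ with $x-y\in C$; it is strongly ordered with $C$ if $x-y\in\operatorname{Int}C$ for all distinct $x,y\in S$. **UESM.** $\Phi$ is UESM with respect to a solid cone $C$ if there is $T(C)>0$ such that $x-y\in C\setminus\{0\}$ implies $\Phi_t(x)-\Phi_t(y)\in\operatorname{Int}C$ for all $t\ge T(C)$. **NICs.** A sequence of closed sets $\{C^i\}_{i=0}^N$, $N\in\mathbb{N}\cup\{+\infty\}$, is called NICs for $\Phi$ if: (i) $\{0\}=C^0\subset\dots\subset C^{i-1}\subset C^i\subset\dots\subset C^N=X$; (ii) $C^i$ is a solid $k_i$-cone for all $0<i<N$, with $k_{i-1}<k_i$ for all $1<i<N$; (iii) for each $1\le i<N$ there is $t_*^i\ge0$ such that $x-y\in C^i$ implies $\Phi_t(x)-\Phi_t(y)\in C^i$ for every $t\ge t_*^i$. $\Phi$ is UESM with respect to the NICs if it is UESM with respect to $C^i$ for every $1\le i<N$. **Index convention.** If $N=+\infty$, the indices are $0,1,2,\dots$ together with $\infty$ (with $C^\infty=X$); the value $j=\infty$ is allowed, in which case ''$i=0,\dots,j-1$'' means all finite $i$. *)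

(* Defs.v *)
From HB Require Import structures.
From mathcomp Require Import all_boot all_order all_algebra.
From mathcomp Require Import all_classical all_reals all_analysis.

Set Implicit Arguments.
Unset Strict Implicit.
Unset Printing Implicit Defensive.

Import Order.TTheory GRing.Theory Num.Theory.
Import numFieldNormedType.Exports.

Local Open Scope classical_set_scope.
Local Open Scope ring_scope.

(* Natural numbers extended by a top element: the range of the indices of a
   possibly infinite sequence of cones. *)
Inductive enat := Fin of nat | Infty.

Definition enat_le (i j : enat) : bool :=
  match i, j with
  | _, Infty => true
  | Infty, Fin _ => false
  | Fin m, Fin n => (m <= n)%N
  end.

Definition enat_lt (i j : enat) : bool := ~~ enat_le j i.

Section Semiflows.
Variables (R : realType) (X : completeNormedModType R).
Implicit Types (Phi : R -> X -> X) (A D G S : set X) (x y : X) (t s : R).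

(* The time set is [0, +oo[: the values Phi t x for t < 0 are unconstrained
   and none of the notions below refers to them. *)
Definition semiflow Phi : Prop :=
  [/\ {within [set p : R * X | 0 <= p.1],
        continuous (fun p : R * X => Phi p.1 p.2)},
      forall x, Phi 0 x = x
    & forall t s, 0 <= t -> 0 <= s -> forall x, Phi t (Phi s x) = Phi (t + s) x].

Definition eventually_compact Phi : Prop :=
  exists2 tau : R, 0 < tau &
    forall D, bounded_set D -> compact (closure (Phi tau @` D)).

Definition invariant_set Phi A : Prop := forall t, 0 <= t -> Phi t @` A = A.

(* Extended reals are used because the supremum of an unbounded set of reals
   has a junk value; D is nonempty because the supremum of the empty set of
   extended reals is -oo. *)
Definition global_attractor Phi G : Prop :=
  [/\ G !=set0, compact G, invariant_set Phi G
    & forall D, D !=set0 -> bounded_set D ->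
        ereal_sup [set ereal_inf [set (`|a - b|)%:E | b in G]
                  | a in Phi t @` D] @[t --> +oo] --> 0%E].

Definition omega_limit Phi x : set X :=
  \bigcap_(t in [set t | 0 <= t])
    closure (\bigcup_(s in [set s | t <= s]) [set Phi s x]).

Definition recurrent_set Phi : set X := [set x | omega_limit Phi x x].

Definition birkhoff_center Phi : set X := closure (recurrent_set Phi).

Definition is_component A S : Prop :=
  exists2 x, A x & S = connected_component A x.

End Semiflows.

Section Cones.
Variables (R : realType) (X : completeNormedModType R).
Implicit Types (C W S : set X) (n k : nat).

Definition lin_subspace W : Prop := GRing.submod_closed (mem W).

Definition lin_indep n (e : 'I_n -> X) : Prop :=
  forall a : 'I_n -> R, \sum_(i < n) a i *: e i = 0 -> forall i, a i = 0.

Definition has_dim W n : Prop :=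
  exists2 e : 'I_n -> X, lin_indep e
    & W = [set \sum_(i < n) a i *: e i | a in [set: 'I_n -> R]].

(* The last two clauses say that k is the maximal dimension of a linear
   subspace contained in C; in particular C contains no infinite-dimensional
   subspace. *)
Definition kcone k C : Prop :=
  [/\ closed C,
      forall (l : R) (v : X), C v -> C (l *: v),
      exists W, [/\ lin_subspace W, W `<=` C & has_dim W k]
    & forall W, lin_subspace W -> W `<=` C ->
        exists2 n : nat, (n <= k)%N & has_dim W n].

Definition solid C : Prop := C° !=set0.

Definition unordered C S : Prop :=
  ~ exists x y : X, [/\ S x, S y, x != y & C (x - y)].

Definition strongly_ordered C S : Prop :=
  forall x y : X, S x -> S y -> x != y -> C° (x - y).

Definition uesm (Phi : R -> X -> X) C : Prop :=
  exists2 T : R, 0 < T &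
    forall x y : X, (C `\ 0) (x - y) ->
      forall t : R, T <= t -> C° (Phi t x - Phi t y).

(* Only the sets C i with i <= N are meaningful.  A finite length N is a
   positive integer. *)
Definition nics (Phi : R -> X -> X) (N : enat) (C : enat -> set X) : Prop :=
  [/\ enat_lt (Fin 0) N,
      forall i, enat_le i N -> closed (C i),
      [/\ C (Fin 0) = [set 0], C N = setT
        & forall i j, enat_le i j -> enat_le j N -> C i `<=` C j],
      exists k : nat -> nat,
        (forall n, (0 < n)%N -> enat_lt (Fin n) N ->
           solid (C (Fin n)) /\ kcone (k n) (C (Fin n))) /\
        (forall n, (1 < n)%N -> enat_lt (Fin n) N -> (k n.-1 < k n)%N)
    & forall n, (1 <= n)%N -> enat_lt (Fin n) N ->
        exists2 t0 : R, 0 <= t0 &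
          forall x y : X, C (Fin n) (x - y) ->
            forall t : R, t0 <= t -> C (Fin n) (Phi t x - Phi t y)].

Definition uesm_nics (Phi : R -> X -> X) (N : enat) (C : enat -> set X) : Prop :=
  forall n, (1 <= n)%N -> enat_lt (Fin n) N -> uesm Phi (C (Fin n)).

End Cones.

(* Main.v *)
Require Import Defs.
From HB Require Import structures.
From mathcomp Require Import all_boot all_order all_algebra.
From mathcomp Require Import all_classical all_reals all_analysis.
From mathcomp Require Import lra.
(* For a single cone C, every difference of two distinct points of the Birkhoff
   center lies either in Int C or outside C; both sets are open and symmetric,
   so the pairs of distinct points of a connected set B all fall on the same
   side.  Nestedness then yields j as the least index for which B is strongly
   ordered.

   The dichotomy for pairs comes from a backward statement on recurrent points:
   if Phi_T x - Phi_T y is in C \ {0} then so is x - y.  If x is in the closure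
   of the orbit of y, approximate the pair by pairs on the orbit of y, which
   return to themselves simultaneously.  Otherwise x stays at a positive
   distance from the orbit of y, so that Phi_t x may be replaced by x at every
   approximate return without leaving C; since the return times of x contain an
   interval, some multiple of one of them is a return time of y. *)

Set Implicit Arguments.
Unset Strict Implicit.
Unset Printing Implicit Defensive.

Import Order.TTheory GRing.Theory Num.Theory.
Import numFieldNormedType.Exports.

Local Open Scope classical_set_scope.
Local Open Scope ring_scope.

(** * Closures in topological spaces *)

Lemma closure_sub_closed (T : topologicalType) (A D : set T) :
  closed D -> A `<=` D -> closure A `<=` D.
Proof. by move=> Dcl /closure_subset AD x /AD; rewrite -(closure_id D).1. Qed.

Lemma continuous_closure (T U : topologicalType) (f : T -> U) (A : set T) x :
  continuous f -> closure A x -> closure (f @` A) (f x).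
Proof.
move=> fc Ax V /fc Vf; have [z [Az Vz]] := Ax _ Vf.
by exists (f z); split => //; exists z.
Qed.

Lemma closure_nbhs (T : topologicalType) (A V : set T) x :
  closure A x -> nbhs x V -> closure (A `&` V) x.
Proof.
move=> Ax Vx W Wx; have [z [Az [Vz Wz]]] := Ax _ (filterI Vx Wx).
by exists z.
Qed.

(** * Two-colourings of the pairs of a connected set *)

Section Coloring.
Variables (R : realType) (X : completeNormedModType R).
Implicit Types (O U B : set X).

(* For x in B and y on the O-side of x, the points w on the U-side of x whose
   difference with y lies in U form a subset of B that is open (U is) and
   closed (its complement is described by O), and that misses y. *)
Lemma connected_split_pair O U B x y z : connected B ->
  open O -> open U -> O `&` U = set0 ->
  (forall v, O v -> O (- v)) -> (forall v, U v -> U (- v)) -> ~ O 0 -> ~ U 0 ->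
  (forall a b, B a -> B b -> a != b -> O (a - b) \/ U (a - b)) ->
  B x -> B y -> B z -> O (y - x) -> U (z - x) -> O (y - z).
Proof.
move=> Bco Oo Uo OU OS US O0 U0 B2 Bx By Bz Oyx Uzx.
have dis v : O v -> U v -> False by move=> Ov Uv; have : (O `&` U) v by []; rewrite OU.
have sx : continuous (fun w : X => w - x).
  by move=> w; apply: cvgB => //; apply: cvg_cst.
have sy : continuous (fun w : X => y - w).
  by move=> w; apply: cvgB => //; apply: cvg_cst.
have yz : y != z by apply/eqP => yz; apply: (dis (y - x)) => //; rewrite yz.
case: (B2 y z By Bz yz) => // Uyz; exfalso.
pose M := B `&` [set w | U (w - x) /\ U (y - w)].
suff BM : M = B by have : M y; [rewrite BM | case=> _ [_]; rewrite subrr].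
apply: Bco.
- by exists z; split.
- exists [set w | U (w - x) /\ U (y - w)] => //.
  by apply: openI; apply: open_comp.
exists [set w | ~ O (w - x) /\ ~ O (y - w)].
  by apply: closedI; apply: open_closedC; apply: (open_comp _ Oo).
apply/seteqP; split=> w [Bw [h1 h2]]; split => //; split.
- by move=> /dis; exact.
- by move=> /dis; exact.
- have wx : w != x by apply/eqP => wx; apply: h2; rewrite wx.
  by case: (B2 w x).
- have yw : y != w by apply/eqP => yw; apply: h1; rewrite -yw.
  by case: (B2 y w).
Qed.

(** Exchanging the colours in [connected_split_pair] puts [y - z] in both [O] and [U], so no point
    of [B] sees both colours ([mono]). The colour of one pair then spreads to all pairs through
    shared endpoints. *)
Lemma connected_two_coloring O U B : connected B ->
  open O -> open U -> O `&` U = set0 ->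
  (forall v, O v -> O (- v)) -> (forall v, U v -> U (- v)) -> ~ O 0 -> ~ U 0 ->
  (forall a b, B a -> B b -> a != b -> O (a - b) \/ U (a - b)) ->
  (forall a b, B a -> B b -> a != b -> O (a - b)) \/
  (forall a b, B a -> B b -> a != b -> U (a - b)).
Proof.
move=> Bco Oo Uo OU OS US O0 U0 B2.
have dis v : O v -> U v -> False by move=> Ov Uv; have : (O `&` U) v by []; rewrite OU.
have mono x y z : B x -> B y -> B z -> O (y - x) -> U (z - x) -> False.
  move=> Bx By Bz Oyx Uzx; apply: (dis (y - z)).
    exact: (connected_split_pair Bco Oo Uo OU OS US O0 U0 B2 Bx By Bz).
  have UO : U `&` O = set0 by rewrite setIC.
  have B2' a b : B a -> B b -> a != b -> U (a - b) \/ O (a - b).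
    by move=> Ba Bb ab; case: (B2 a b Ba Bb ab); [right|left].
  rewrite -opprB; apply: (US).
  exact: (connected_split_pair Bco Uo Oo UO US OS U0 O0 B2' Bx Bz By).
have [allO|] := pselect (forall a b, B a -> B b -> a != b -> O (a - b)).
  by left.
move=> /existsNP[a /existsNP[b /not_implyP[Ba /not_implyP[Bb /not_implyP[ab nO]]]]].
have Uab : U (a - b) by case: (B2 a b Ba Bb ab).
have bside c : B c -> c != b -> U (c - b).
  move=> Bc cb; case: (B2 c b Bc Bb cb) => // Ocb.
  by case: (mono b c a).
right=> c d Bc Bd cd.
case: (eqVneq c b) cd => [-> bd|cb cd].
  by rewrite -opprB; apply: (US); apply: bside => //; rewrite eq_sym.
case: (B2 c d Bc Bd cd) => // Ocd; exfalso.
apply: (mono c d b) => //; first by rewrite -opprB; apply: (OS).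
by rewrite -opprB; apply: (US); apply: bside.
Qed.
End Coloring.

(** * Transfer of cone relations from a set of pairs to its closure *)

Section ClosurePairs.
Variables (R : realType) (X : completeNormedModType R).
Variables (f : X -> X) (C : set X) (Q : set (X * X)).
Let F (p : X * X) := (f p.1, f p.2).
Let D : set (X * X) := [set p | C (p.1 - p.2)].

Hypothesis f_cont : continuous f.
Hypothesis C_closed : closed C.
Hypothesis C0 : ~ C° 0.
Hypothesis f_mono : forall a b : X, a != b -> C (a - b) -> C° (f a - f b).
Hypothesis Q_compact : compact (closure Q).
Hypothesis Q_inv : F @` Q `<=` Q.
Hypothesis Q_sur : Q `<=` closure (F @` Q).
Hypothesis Q_back :
  forall p, Q p -> f p.1 != f p.2 -> C (f p.1 - f p.2) -> C (p.1 - p.2).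

Let F_cont : continuous F.
Proof.
move=> p; apply: cvg_pair => /=.
  by apply: (@continuous_comp _ _ _ fst f); [exact: cvg_fst|exact: f_cont].
by apply: (@continuous_comp _ _ _ snd f); [exact: cvg_snd|exact: f_cont].
Qed.

Let d_cont : continuous (fun p : X * X => p.1 - p.2).
Proof. by move=> p; apply: cvgB; [exact: cvg_fst|exact: cvg_snd]. Qed.

Let D_closed : closed D.
Proof. exact: (continuous_closedP _).1 d_cont _ C_closed. Qed.

Let int_neq a b : C° (a - b) -> a != b.
Proof. by move=> h; apply/eqP => ab; apply: C0; rewrite ab subrr in h. Qed.

Let near_F p : C° (f p.1 - f p.2) -> nbhs p [set q | C° (f q.1 - f q.2)].
Proof.
move=> Cp.
have dF : nbhs (F p) [set q | C° (q.1 - q.2)].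
  by apply: d_cont; apply: open_nbhs_nbhs; split=> //; exact: open_interior.
exact: F_cont dF.
Qed.

(** The pair [(a, b)] turns out to be the [F]-image of a pair whose difference already lies in [C];
    one application of [f_mono] then reaches the interior. *)
Lemma closure_pairs_interior a b :
  closure Q (a, b) -> a != b -> C (a - b) -> C° (a - b).
Proof.
move=> Qab ab Cab.
have Fab : closure (F @` Q) (a, b).
  exact: closure_sub_closed (@closed_closure _ _) Q_sur _ Qab.
have : closure (F @` (closure Q `&` D)) (a, b).
  (* Since [f a - f b] is interior to [C], so is [f (f u) - f (f v)] for every image pair
     [(f u, f v)] near [(a, b)]; two uses of [Q_back] bring this down to [u - v]. *)
  have := closure_nbhs Fab (@near_F (a, b) (f_mono ab Cab)).
  apply: closure_subset => _ [[[u v] Quv <-] Cuv] /=.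
  exists (u, v) => //; split; first exact: subset_closure.
  have /= Fuv : C (f u - f v).
    apply: (Q_back (p := F (u, v))); first by apply: Q_inv; exists (u, v).
      exact: int_neq.
    exact: interior_subset.
  apply: (Q_back Quv) => //=.
  by apply: contra_not_neq C0 => uv; move: Cuv; rewrite /= uv subrr.
(* Compactness makes this image closed, so the limit [(a, b)] has an exact preimage with difference
   in [C]. *)
have FD : compact (F @` (closure Q `&` D)).
  apply: continuous_compact; first exact: continuous_subspaceT.
  apply: (subclosed_compact _ Q_compact); last by move=> ? [].
  by apply: closedI => //; exact: closed_closure.
move=> /(compact_closed (@norm_hausdorff _ _) FD)[[u v] [_ Duv]] [ua vb].
rewrite -ua -vb; apply: f_mono => //.
by apply: contraNneq ab => uv; rewrite -ua -vb uv.
Qed.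

(** By [closure_pairs_interior] the hypothesis on [f a - f b] improves to an open condition, which
    holds at pairs of [Q] near [(a, b)]. There [Q_back] applies, and its conclusion is closed, hence
    passes to the limit. *)
Lemma closure_pairs_back a b : closure Q (a, b) ->
  f a != f b -> C (f a - f b) -> C (a - b).
Proof.
move=> Qab fab Cf.
have Cfi : C° (f a - f b).
  apply: closure_pairs_interior => //.
  by apply: (closure_subset Q_inv); exact: (continuous_closure F_cont Qab).
have := closure_nbhs Qab (@near_F (a, b) Cfi).
apply: (closure_sub_closed D_closed) => -[u v] [Quv /= Cuv].
apply: (Q_back Quv); first exact: int_neq.
exact: interior_subset.
Qed.

End ClosurePairs.

(** * Recurrent points of a semiflow *)

Section Recurrence.
Variables (R : realType) (X : completeNormedModType R) (Phi : R -> X -> X).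
Hypothesis Phi_semiflow : semiflow Phi.
Implicit Types (x y : X) (s t M e : R).

Let PhiD t s x : 0 <= t -> 0 <= s -> Phi t (Phi s x) = Phi (t + s) x.
Proof. by case: Phi_semiflow => _ _ h t0 s0; exact: h. Qed.

Let Phi_near t x V : 0 <= t -> nbhs (Phi t x) V ->
  nbhs (t, x) [set p : R * X | 0 <= p.1 -> V (Phi p.1 p.2)].
Proof.
move=> t0 Vtx; case: Phi_semiflow => /subspace_continuousP h _ _.
exact: (h (t, x) t0 V Vtx).
Qed.

Lemma semiflow_continuous t : 0 <= t -> continuous (Phi t).
Proof.
move=> t0 x V /(Phi_near t0) Vtx.
have c : (t, z) @[z --> x] --> (t, x) by exact: cvg_pair (cvg_cst t) cvg_id.
by apply: (@filterS _ (nbhs x) _ _ _ _ (c _ Vtx)) => z; exact.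
Qed.

Lemma semiflow_continuous_time t x e : 0 <= t -> 0 < e ->
  exists2 d, 0 < d &
    forall s, t <= s -> s <= t + d -> `|Phi t x - Phi s x| < e.
Proof.
move=> t0 e0.
have c : (z, x) @[z --> t] --> (t, x) by exact: cvg_pair cvg_id (cvg_cst x).
have /c/nbhs_ballP[d /= d0 dP] := Phi_near t0 (nbhsx_ballx (Phi t x) e e0).
exists (d / 2); first by rewrite divr_gt0.
move=> s ts sd; have : ball (Phi t x) e (Phi s x).
  apply: (dP s) => /=; last by lra.
  by rewrite /ball /= ltr_norml; apply/andP; split; lra.
by rewrite -ball_normE.
Qed.

Lemma recurrentP x : recurrent_set Phi x <->
  forall M, 0 <= M -> closure [set Phi s x | s in [set s | M <= s]] x.
Proof.
have E M : \bigcup_(s in [set s | M <= s]) [set Phi s x] =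
    [set Phi s x | s in [set s | M <= s]].
  by apply/seteqP; split=> z [s /= Ms] => [->|<-]; exists s.
by split=> [h M /h|h M M0]; rewrite E //; exact: h.
Qed.

Lemma recurrent_return x M e : recurrent_set Phi x -> 0 <= M -> 0 < e ->
  exists2 s, M <= s & `|x - Phi s x| < e.
Proof.
move=> /recurrentP xr M0 e0.
have [_ [[s /= Ms <-]]] := xr M M0 _ (nbhsx_ballx x e e0).
by rewrite -ball_normE; exists s.
Qed.

Lemma recurrent_semiflow x t :
  recurrent_set Phi x -> 0 <= t -> recurrent_set Phi (Phi t x).
Proof.
move=> /recurrentP xr t0; apply/recurrentP => M M0.
apply: closure_subset (continuous_closure (semiflow_continuous t0) (xr M M0)).
move=> _ [_ [s /= Ms <-] <-]; exists s => //.
by rewrite !PhiD ?(le_trans M0 Ms)// addrC.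
Qed.

(** Both coordinates are continuous functions of [x], so a single return of [x] brings the two orbit
    points back simultaneously. *)
Lemma recurrent_orbit_pair x s t M :
  recurrent_set Phi x -> 0 <= s -> 0 <= t -> 0 <= M ->
  closure [set (Phi r (Phi s x), Phi r (Phi t x)) | r in [set r | M <= r]]
    (Phi s x, Phi t x).
Proof.
move=> /recurrentP xr s0 t0 M0.
have c : continuous (fun z => (Phi s z, Phi t z)).
  by move=> z; apply: cvg_pair; apply: semiflow_continuous.
apply: closure_subset (continuous_closure c (xr M M0)).
move=> _ [_ [r /= Mr <-] <-]; exists r => //.
by rewrite !PhiD ?(le_trans M0 Mr)// ![r + _]addrC.
Qed.

(** A late return of [x] is close to [x] and, since the singleton of [x] is attracted, also close to
    [G], which is closed. *)
Lemma recurrent_attractor G : global_attractor Phi G -> recurrent_set Phi `<=` G.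
Proof.
move=> [G0 Gc _ Gattr] x xr.
have Gcl := compact_closed (@norm_hausdorff _ _) Gc.
apply: contrapT => nGx.
have /nbhs_ballP[e /= e0 eG] : nbhs x (~` G).
  by apply: open_nbhs_nbhs; split => //; exact: closed_openC.
have e20 : 0 < e / 2 by rewrite divr_gt0.
have xb : bounded_set [set x].
  exists `|x|; split; first exact: normr_real.
  by move=> M xM _ ->; exact: ltW.
have /(_ [set y | y < (e / 2)%:E]%E)[] := Gattr _ (ex_intro _ x erefl) xb.
  by apply: open_nbhs_nbhs; split; [exact: open_ereal_lt_ereal|rewrite /= lte_fin].
move=> M [_ MP].
(* The maximum makes the time nonnegative, and the added 1 makes it exceed [M] strictly. *)
have M0 : 0 <= Num.max 0 M + 1 by rewrite addr_ge0// le_max lexx.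
have [s Ms xs] := recurrent_return xr M0 e20.
have /MP /= : M < s.
  by apply: lt_le_trans Ms; rewrite (le_lt_trans (_ : _ <= Num.max 0 M)) ?ltrDl// le_max lexx orbT.
move=> supe.
have : (ereal_inf [set (`|Phi s x - b|)%:E | b in G] < (e / 2)%:E)%E.
  apply: le_lt_trans supe; apply: ereal_sup_ubound.
  by exists (Phi s x) => //; exists x.
move=> /ereal_inf_lt[_ [b Gb <-]]; rewrite lte_fin => sb.
apply: (eG b) => //; rewrite -ball_normE /=.
rewrite -[x - b](subrKA (Phi s x)) (le_lt_trans (ler_normD _ _))//.
by rewrite [e]splitr ltrD.
Qed.

End Recurrence.

(** With [n] the integer part of [q / p], the quotient [q / n] exceeds [p] by less than [p / n],
    which is at most [d] once [n >= m]. This serves to make a multiple of a return time of one point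
    a return time of another. *)
Lemma quotient_in_interval (R : realType) (p d : R) : 0 < p -> 0 < d ->
  exists2 M, 0 <= M & forall q, M <= q ->
    exists n : nat, p <= q / n.+1%:R /\ q / n.+1%:R <= p + d.
Proof.
move=> p0 d0; pose m := (Num.trunc (p / d)).+1.
have pm : p < m%:R * d.
  rewrite -ltr_pdivrMr//.
  by have /andP[] := truncn_itv (divr_ge0 (ltW p0) (ltW d0)).
exists (p * m.+1%:R); first by rewrite mulr_ge0// ltW.
move=> q Mq.
have q0 : 0 <= q by apply: le_trans Mq; rewrite mulr_ge0// ltW.
have /andP[] := truncn_itv (divr_ge0 q0 (ltW p0)).
set n := Num.trunc (q / p); rewrite ler_pdivlMr// ltr_pdivrMr// => nq qn.
have mn : (m <= n)%N.
  rewrite -ltnS -(ltr_nat R) -(ltr_pM2r p0); apply: le_lt_trans qn.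
  by rewrite mulrC (le_trans _ Mq)// ler_pM2l// ler_nat.
have n0 : (0 < n)%N by apply: leq_trans mn.
(* The denominator in the statement is a successor, hence the predecessor here. *)
exists n.-1; rewrite (prednK n0).
rewrite ler_pdivlMr ?ltr0n// ler_pdivrMr ?ltr0n//; split; first by rewrite mulrC.
have : m%:R * d <= n%:R * d by rewrite ler_pM2r// ler_nat.
by move: qn; rewrite -natr1 => ? ?; lra.
Qed.

(** * The backward statement and the dichotomy for a single cone *)

Section Cone.
Variables (R : realType) (X : completeNormedModType R) (Phi : R -> X -> X).
Variables (G C : set X) (T : R).
Hypothesis Phi_semiflow : semiflow Phi.
Hypothesis G_attractor : global_attractor Phi G.
Hypothesis C_closed : closed C.
Hypothesis C_int0 : ~ C° 0.
Hypothesis T_gt0 : 0 < T.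
Hypothesis C_mono : forall x y, (C `\ 0) (x - y) ->
  forall t, T <= t -> C° (Phi t x - Phi t y).
Implicit Types (x y a b : X) (s t : R).

Let T_ge0 : 0 <= T. Proof. exact: ltW. Qed.

Let PhiD t s x : 0 <= t -> 0 <= s -> Phi t (Phi s x) = Phi (t + s) x.
Proof. by case: Phi_semiflow => _ _ h t0 s0; exact: h. Qed.

Let mono t a b : T <= t -> a != b -> C (a - b) -> C° (Phi t a - Phi t b).
Proof. by move=> Tt ab Cab; apply: C_mono => //; split=> //=; apply/eqP; rewrite subr_eq0. Qed.

Let mono_weak t a b : T <= t -> C (a - b) -> C (Phi t a - Phi t b).
Proof.
move=> Tt; case: (eqVneq a b) => [->|ab Cab]; first by rewrite !subrr.
by apply: interior_subset; exact: mono.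
Qed.

Let G_compact : compact G. Proof. by case: G_attractor. Qed.

Let G_inv x t : 0 <= t -> G x -> G (Phi t x).
Proof. by case: G_attractor => _ _ Ginv _ t0 Gx; rewrite -(Ginv t t0); exists x. Qed.

Let compact_closure_sub (Q : set (X * X)) : Q `<=` G `*` G -> compact (closure Q).
Proof.
have GG := compact_setX G_compact G_compact.
have GGc := compact_closed (@norm_hausdorff _ _) GG.
move=> QG; apply: (subclosed_compact _ GG); first exact: closed_closure.
exact: closure_sub_closed.
Qed.

(** [closure_pairs_back] is applied to the pairs of points on the orbit of [y]. Their simultaneous
    returns show both that they are limits of image pairs and that the backward property holds for
    them. *)
Lemma orbit_closure_back x y : recurrent_set Phi y ->
  closure [set Phi s y | s in [set s | 0 <= s]] x ->
  Phi T x != Phi T y -> C (Phi T x - Phi T y) -> C (x - y).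
Proof.
move=> yr xy.
set O := [set Phi s y | s in [set s | 0 <= s]] in xy.
have Gy := recurrent_attractor G_attractor yr.
have Oy : O y by exists 0 => //=; case: Phi_semiflow.
apply: (@closure_pairs_back _ _ (Phi T) C (O `*` O)) => //.
- exact: semiflow_continuous.
- by move=> a b; exact: mono.
- apply: compact_closure_sub => -[_ _] [[s /= s0 <-] [t /= t0 <-]].
  by split; exact: G_inv.
- move=> _ [[_ _] [[s /= s0 <-] [t /= t0 <-]] <-].
  by split; [exists (T + s)|exists (T + t)]; rewrite /= ?PhiD ?addr_ge0.
- move=> [_ _] [[s /= s0 <-] [t /= t0 <-]].
  apply: closure_subset (recurrent_orbit_pair Phi_semiflow yr s0 t0 T_ge0).
  move=> _ [r /= Tr <-].
  have r0 : 0 <= r - T by rewrite subr_ge0.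
  exists (Phi (r - T + s) y, Phi (r - T + t) y).
    by split; [exists (r - T + s)|exists (r - T + t)] => //=; rewrite addr_ge0.
  have r0' : 0 <= r by apply: le_trans Tr.
  by rewrite /= !PhiD ?(addr_ge0 r0)// ![T + (r - T + _)]addrA !subrKC.
- move=> [_ _] [[s /= s0 <-] [t /= t0 <-]] /= fst Cst.
  (* Returns at times [r >= T + T] leave [r - T >= T], enough to carry the relation from time [T] to
     time [r] by monotonicity. *)
  have T2 : 0 <= T + T by rewrite addr_ge0.
  have Dcl : closed [set p : X * X | C (p.1 - p.2)].
    apply: ((continuous_closedP _).1 _ _ C_closed) => p.
    by apply: cvgB; [exact: cvg_fst|exact: cvg_snd].
  apply: (closure_sub_closed Dcl _ (recurrent_orbit_pair Phi_semiflow yr s0 t0 T2)).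
  move=> _ [r /= Tr <-] /=.
  have rE : r = (r - T) + T by rewrite subrK.
  have Tr' : T <= r - T by rewrite lerBrDr.
  have rT : 0 <= r - T by apply: le_trans Tr'.
  by rewrite rE -!(PhiD _ rT T_ge0); exact: mono_weak.
- have c : continuous (fun z : X => (z, y)).
    by move=> z; exact: cvg_pair cvg_id (cvg_cst y).
  by apply: closure_subset (continuous_closure c xy) => _ [z Oz <-].
Qed.

(** Each difference concerned is interior to [C], and compactness makes the radius uniform. The
    bound [d] keeps the differences away from 0, which is not interior to [C]. *)
Lemma cone_radius (d : R) : 0 < d -> exists2 e : R, 0 < e &
  forall a b w, G a -> G b -> C (a - b) -> d <= `|Phi T a - Phi T b| ->
    `|Phi T a - Phi T b - w| < e -> C w.
Proof.
move=> d0; pose g (p : X * X) := Phi T p.1 - Phi T p.2.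
have Tcont := semiflow_continuous Phi_semiflow T_ge0.
have dcont : continuous (fun p : X * X => p.1 - p.2).
  by move=> p; apply: cvgB; [exact: cvg_fst|exact: cvg_snd].
have gcont : continuous g.
  move=> p; apply: cvgB.
    by apply: (@continuous_comp _ _ _ fst (Phi T)); [exact: cvg_fst|exact: Tcont].
  by apply: (@continuous_comp _ _ _ snd (Phi T)); [exact: cvg_snd|exact: Tcont].
pose A := G `*` G `&` ([set p | C (p.1 - p.2)] `&` [set p | d <= `|g p|]).
have GG := compact_setX G_compact G_compact.
have Acomp : compact A.
  apply: (subclosed_compact _ GG); last by move=> ? [].
  apply: closedI; first exact: compact_closed (@norm_hausdorff _ _) GG.
  apply: closedI; first exact: ((continuous_closedP _).1 dcont _ C_closed).
  have ngcont : continuous (fun p => `|g p|).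
    by move=> p; apply: cvg_norm; exact: gcont.
  by apply: ((continuous_closedP _).1 ngcont [set r | d <= r]); exact: closed_ge.
have : compact (g @` A).
  by apply: continuous_compact => //; exact: continuous_subspaceT.
move=> /compact_near_coveringP/(_ X (nbhs 0) (fun u v => C (v + u)) _).
have P v : (g @` A) v -> \forall v' \near v & u \near (0 : X), C (v' + u).
  move=> [[a b] [_ [/= Cab dab]] <-].
  have Cg : C° (g (a, b) + 0).
    rewrite addr0; apply: mono => //.
    by apply: contraTneq dab => /= ->; rewrite /g /= subrr normr0 -ltNge.
  have c : continuous (fun z : X * X => z.1 + z.2).
    by move=> z; apply: cvgD; [exact: cvg_fst|exact: cvg_snd].
  exact: (c (g (a, b), 0) C Cg).
move=> /(_ P)/nbhs_ballP[e /= e0 eP]; exists e => // a b w Ga Gb Cab dab we.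
rewrite -[w](subrKC (Phi T a - Phi T b)); apply: (eP (w - (Phi T a - Phi T b))).
  by rewrite -ball_normE /= sub0r opprB.
by exists (a, b).
Qed.

Lemma recurrent_jump_back x y : recurrent_set Phi x -> recurrent_set Phi y ->
  ~ closure [set Phi s y | s in [set s | 0 <= s]] x ->
  C (Phi T x - Phi T y) -> C (x - y).
Proof.
move=> xr yr xy Cxy.
have Gx := recurrent_attractor G_attractor xr.
have Gy := recurrent_attractor G_attractor yr.
have [d d0 dist_d] : exists2 d, 0 < d & forall s, 0 <= s -> d <= `|x - Phi s y|.
  have : nbhs x (~` closure [set Phi s y | s in [set s | 0 <= s]]).
    by apply: open_nbhs_nbhs; split => //; exact/closed_openC/closed_closure.
  move=> /nbhs_ballP[d /= d0 dP]; exists d => // s s0; rewrite leNgt.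
  apply/negP => sd; apply: (dP (Phi s y)); first by rewrite -ball_normE.
  by apply: subset_closure; exists s.
have d20 : 0 < d / 2 by rewrite divr_gt0.
have [e e0 eP] := cone_radius d20.
(* The bound [d / 2] keeps [Phi t x] far from the orbit of [y]; the bound [e / 2] leaves room for
   two errors, one at [x] and one at [y], in the last replacement. *)
pose h := Num.min (e / 2) (d / 2).
have h0 : 0 < h by rewrite lt_min divr_gt0.
have he : h <= e / 2 by rewrite ge_min lexx.
have hd : h <= d / 2 by rewrite ge_min lexx orbT.
have h20 : 0 < h / 2 by rewrite divr_gt0.
(* The induction below starts from the relation at time [T] and needs a further time
   [t - T - T >= T] to reach [t - T]. *)
have T30 : 0 <= T *+ 3 by rewrite mulrn_wge0.
have [p Tp xp] := recurrent_return xr T30 h20.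
have p0 : 0 < p by apply: lt_le_trans Tp; rewrite pmulrn_lgt0.
(* All times in [[p, p + r]] are approximate returns of [x]; [t] is chosen among them as a fraction
   of a return time [q] of [y]. *)
have [r r0 rP] := semiflow_continuous_time Phi_semiflow x (ltW p0) h20.
have [M M0 MP] := quotient_in_interval p0 r0.
have [q Mq yq] := recurrent_return yr M0 h0.
have [n [pn nr]] := MP q Mq.
set t := q / n.+1%:R in pn nr.
have qt : n.+1%:R * t = q by rewrite mulrC divfK.
have T3t : T *+ 3 <= t by apply: le_trans Tp pn.
have t0 : 0 < t by apply: lt_le_trans pn.
have xt : `|x - Phi t x| < h.
  rewrite -[x - _](subrKA (Phi p x)) (le_lt_trans (ler_normD _ _))//.
  by rewrite [h]splitr ltrD// rP.
have t1 : T <= t - T by lra.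
have t10 : 0 <= t - T by lra.
have kt0 k : 0 <= k%:R * t by rewrite mulr_ge0// ltW.
have kt1 k : 0 <= t - T + k%:R * t by rewrite addr_ge0.
have yE k : Phi T (Phi (t - T + k%:R * t) y) = Phi (k.+1%:R * t) y.
  by rewrite PhiD// addrA subrKC -natr1 mulrDl mul1r addrC.
have xE : Phi T (Phi (t - T) x) = Phi t x by rewrite PhiD// subrKC.
have far k : d / 2 <= `|Phi T (Phi (t - T) x) - Phi T (Phi (t - T + k%:R * t) y)|.
  rewrite xE yE; have := dist_d _ (kt0 k.+1).
  have := ler_normD (x - Phi t x) (Phi t x - Phi (k.+1%:R * t) y).
  by rewrite subrKA => ? ?; lra.
have near k w : C (Phi (t - T) x - Phi (t - T + k%:R * t) y) ->
    `|Phi t x - Phi (k.+1%:R * t) y - w| < e -> C w.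
  move=> Ck; rewrite -(yE k) -xE.
  by apply: eP (far k) => //; exact: G_inv.
(* In each round the flow runs for time [T], [Phi t x] is replaced by [x], and the flow runs for
   [t - T]. The first point is thus always at time [t - T], while the second advances by [t]. *)
have step k : C (Phi (t - T) x - Phi (t - T + k%:R * t) y).
  elim: k => [|k IH].
    have tE : t - T = (t - T - T) + T by rewrite subrK.
    have t20 : 0 <= t - T - T by lra.
    rewrite mul0r addr0 tE -!(PhiD _ t20 T_ge0).
    by apply: mono_weak => //; lra.
  rewrite -(PhiD _ t10 (kt0 k.+1)); apply: mono_weak => //.
  apply: (near k) => //.
  by rewrite opprB addrA subrK distrC; lra.
(* Here [y] has reached its return time [q], so both points are replaced at once, with total error
   below [h + h <= e]. *)
apply: (near n) => //; rewrite qt.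
have -> : Phi t x - Phi q y - (x - y) = (y - Phi q y) - (x - Phi t x).
  by rewrite !opprB addrACA [RHS]addrACA [y + _]addrC.
apply: le_lt_trans (ler_normB _ _) _; lra.
Qed.

(** [closure_pairs_interior] is applied to all pairs of recurrent points, whose closure contains
    every pair of points of the Birkhoff center. *)
Lemma birkhoff_pair_interior a b :
  birkhoff_center Phi a -> birkhoff_center Phi b ->
  a != b -> C (a - b) -> C° (a - b).
Proof.
move=> aB bB; set Q := recurrent_set Phi `*` recurrent_set Phi.
have closure_prod (A : set X) u v :
    closure A u -> closure A v -> closure (A `*` A) (u, v).
  move=> uA vA W [[W1 W2] /= [/uA[u' [Au W1u]] /vA[v' [Av W2v]]] W12].
  by exists (u', v'); split => //; exact: W12.
have inv x t : 0 <= t -> recurrent_set Phi x -> recurrent_set Phi (Phi t x).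
  by move=> t0 xr; exact: recurrent_semiflow.
have sur x : recurrent_set Phi x -> closure (Phi T @` recurrent_set Phi) x.
  move=> xr; apply: closure_subset ((recurrentP _ _).1 xr T T_ge0).
  move=> _ [s /= Ts <-]; exists (Phi (s - T) x).
    by apply: inv => //; rewrite subr_ge0.
  by rewrite PhiD ?subr_ge0// subrKC.
apply: (@closure_pairs_interior _ _ (Phi T) C Q) => //.
- exact: semiflow_continuous.
- by move=> u v; exact: mono.
- apply: compact_closure_sub => -[u v] [/= ur vr].
  by split; exact: (recurrent_attractor G_attractor).
- by move=> _ [[u v] [/= ur vr] <-]; split; exact: inv.
- move=> [u v] [/= ur vr].
  apply: closure_subset (closure_prod _ _ _ (sur u ur) (sur v vr)).
  by move=> [_ _] [/= [u' ur' <-] [v' vr' <-]]; exists (u', v').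
- move=> [u v] [/= ur vr] uv Cuv.
  (* Two recurrent points need not return simultaneously, hence the two separate arguments for the
     backward property. *)
  have [uO|uO] := pselect (closure [set Phi s v | s in [set s | 0 <= s]] u).
    exact: orbit_closure_back.
  exact: recurrent_jump_back.
- exact: closure_prod.
Qed.

Lemma connected_ordered_or_unordered (B : set X) :
  (forall (l : R) v, C v -> C (l *: v)) ->
  connected B -> B `<=` birkhoff_center Phi ->
  strongly_ordered C B \/ unordered C B.
Proof.
move=> C_scale Bconn BB.
(* One pair with difference in [C] excludes the colouring lying wholly outside [C]; scaling it by 0
   also gives [C 0]. *)
have [[x [y [Bx By xy Cxy]]]|] :=
  pselect (exists x y, [/\ B x, B y, x != y & C (x - y)]); last by right.
left.
have CN v : C v -> C (- v) by move=> /(C_scale (-1)); rewrite scaleN1r.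
have C0 : C 0 by rewrite -(scale0r (x - y)); exact: C_scale.
have oppc : continuous (fun v : X => - v) by move=> v; exact: opp_continuous.
have intN v : C° v -> C° (- v).
  rewrite -[v in C° v]opprK => Cv.
  apply: (@filterS _ (nbhs (- v)) _ _ _ _ (oppc (- v) _ Cv)).
  by move=> u /= /CN; rewrite opprK.
have disj : C° `&` ~` C = set0.
  by apply/seteqP; split => // v [/interior_subset].
have outN v : (~` C) v -> (~` C) (- v) by move=> nC /CN; rewrite opprK.
have out0 : ~ (~` C) 0 by apply.
have B2 a b : B a -> B b -> a != b -> C° (a - b) \/ (~` C) (a - b).
  move=> Ba Bb ab; have [Cab|] := pselect (C (a - b)); last by right.
  by left; apply: birkhoff_pair_interior => //; exact: BB.
have [//|noC] := connected_two_coloring Bconn (@open_interior _ C)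
  (closed_openC C_closed) disj intN outN C_int0 out0 B2.
by have := noC x y Bx By xy.
Qed.

End Cone.

(** * From one cone to the nested family *)

Lemma scale_closed_interior0 (R : realType) (X : completeNormedModType R) (C : set X) :
  (forall (l : R) v, C v -> C (l *: v)) -> C° 0 -> C = setT.
Proof.
move=> C_scale C0; apply/seteqP; split => // v _.
have c : continuous (fun l : R => l *: v).
  by move=> l; apply: cvgZl; exact: cvg_id.
(* A small positive multiple of [v] lies in [C], and scaling by the inverse factor recovers [v]. *)
have : nbhs (0 : R) [set l : R | C (l *: v)].
  by apply: c; rewrite scale0r.
move=> /nbhs_ballP[e /= e0 /(_ (e / 2))].
rewrite -ball_normE /= sub0r normrN gtr0_norm ?divr_gt0//.
have e2 : e / 2 < e by lra.
move=> /(_ e2)/(C_scale (e / 2)^-1); rewrite scalerA mulVf ?scale1r//.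
by rewrite gt_eqF// divr_gt0.
Qed.

Lemma setT_strongly_ordered (R : realType) (X : completeNormedModType R)
  (B : set X) : strongly_ordered setT B.
Proof. by move=> x y _ _ _; rewrite interiorT. Qed.

Theorem theoremA (R : realType) (X : completeNormedModType R)
    (Phi : R -> X -> X) (Gamma : set X) (N : enat) (C : enat -> set X) :
  semiflow Phi ->
  eventually_compact Phi ->
  global_attractor Phi Gamma ->
  nics Phi N C ->
  uesm_nics Phi N C ->
  forall B : set X, is_component (birkhoff_center Phi) B ->
    exists j : enat,
      [/\ enat_lt (Fin 0) j, enat_le j N,
          forall i : enat, enat_le j i -> enat_le i N -> strongly_ordered (C i) B
        & forall i : enat, enat_lt i j -> unordered (C i) B].
Proof.
move=> sf _ ga [N0 _ [C0 CN Cle] [k [kC _]] _] um B [x0 Bx0 BE].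
have Bconn : connected B by rewrite BE; exact: component_connected.
have Bsub : B `<=` birkhoff_center Phi.
  by rewrite BE; exact: connected_component_sub.
have dich n : (1 <= n)%N -> enat_lt (Fin n) N ->
    strongly_ordered (C (Fin n)) B \/ unordered (C (Fin n)) B.
  move=> n1 nN; have [_ [Ccl Csc _ _]] := kC n n1 nN.
  have [T T0 Cmono] := um n n1 nN.
  (* If 0 is interior, the cone is the whole space and strong ordering is trivial. *)
  have [/(scale_closed_interior0 Csc) ->|Cint] := pselect ((C (Fin n))° 0).
    by left; exact: setT_strongly_ordered.
  exact: (connected_ordered_or_unordered sf ga Ccl Cint T0 Cmono).
have so_up i j : enat_le i j -> enat_le j N ->
    strongly_ordered (C i) B -> strongly_ordered (C j) B.
  move=> ij jN so x y Bx By xy.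
  exact: (interiorS (Cle i j ij jN)) (so x y Bx By xy).
have un0 : unordered (C (Fin 0)) B.
  by move=> [x [y [_ _ xy]]]; rewrite C0 => /eqP; rewrite subr_eq0 (negPf xy).
pose P n := `[< [/\ (1 <= n)%N, enat_lt (Fin n) N & strongly_ordered (C (Fin n)) B] >].
(* The least index satisfying [P] is [j]: nestedness handles the indices above it, minimality and
   [dich] those below. *)
have [exP|nP] := pselect (exists n, P n).
  case: (ex_minnP exP) => n /asboolP[n1 nN so] nmin.
  have nleN : enat_le (Fin n) N.
    by case: (N) nN => // m; rewrite /enat_lt /= -ltnNge => /ltnW.
  exists (Fin n); split => //; first by rewrite /enat_lt /= -ltnNge.
    by move=> i ni iN; exact: (so_up (Fin n)).
  move=> [[|m]|] //; rewrite /enat_lt /= -ltnNge => mn.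
  have mN : enat_lt (Fin m.+1) N.
    case: (N) nN => // p; rewrite /enat_lt /= -!ltnNge; exact: ltn_trans.
  have [//|som|//] := dich m.+1 _ mN.
  have := nmin m.+1; rewrite leqNgt mn => /(_ _)/negP[]//.
  by apply/asboolP.
(* With no such index, [j] is [N] itself, possibly [Infty], where the cone is the whole space. *)
exists N; split => //.
- by case: (N) => //= n.
- move=> i Ni iN; apply: (so_up N) => //.
  by rewrite CN; exact: setT_strongly_ordered.
move=> [[|m]|] // mN; last by case: (N) mN.
have [//|som|//] := dich m.+1 _ mN.
by case: nP; exists m.+1; apply/asboolP.
Qed.
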